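(* Every continuous map $T:[0,1]\to[0,1]$ has zero absolute metric mean dimension, $\operatorname{mdim}_M(T)=0$. More precisely, for every continuous map $T:[0,1]\to[0,1]$ there exists a metric $d$ on $[0,1]$, inducing the usual topology, such that $\operatorname{mdim}_M(T,d)=0$ and $\operatorname{dim}^+_M([0,1],d)=1$.
   Context: Let $T:\Omega\to\Omega$ be a continuous map of a compact space with a metric $d$ inducing its topology. Set $d_n(x,y)=\max\{d(T^k(x),T^k(y))\mid 0\le k<n\}$. A set $S\subset\Omega$ is $(n,\varepsilon)$-separated when $d_n(x,y)\ge\varepsilon$ for all $x\ne y$ in $S$; $N(d,T,\varepsilon,n)$ is the largest cardinality of an $(n,\varepsilon)$-separated set. The metric mean dimension of $T$ relative to $d$ is \[\operatorname{mdim}_M(T,d)=\liminf_{\varepsilon\to0}\limsup_{n\to\infty}\frac{\log N(d,T,\varepsilon,n)}{n\log\frac1\varepsilon},\] and the absolute metric mean dimension is $\operatorname{mdim}_M(T)=\inf_d\operatorname{mdim}_M(T,d)$, where $d$ runs over all metrics on $\Omega$ inducing its topology. The upper Minkowski dimension is $\operatorname{dim}^+_M(\Omega,d)=\limsup_{\varepsilon\to0}\frac{\log N(\Omega,d,\varepsilon)}{\log\frac1\varepsilon}$, where $N(\Omega,d,\varepsilon)$ is the maximal cardinality of an $\varepsilon$-separated subset of $\Omega$ (a subset whose distinct points are at $d$-distance at least $\varepsilon$). *)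

(* Defs.v *)
From HB Require Import structures.
From mathcomp Require Import all_boot all_order all_algebra.
From mathcomp Require Import all_classical all_reals all_analysis.

Set Implicit Arguments.
Unset Strict Implicit.
Unset Printing Implicit Defensive.

Import Order.TTheory GRing.Theory Num.Theory.
Import numFieldNormedType.Exports.

Local Open Scope classical_set_scope.
Local Open Scope ring_scope.

(* The subtype [set_type `[0, 1]], with its subspace topology. *)
Definition I01 (R : realType) : topologicalType :=
  set_type (`[0, 1] : set R).

Section Metrics.
Context {R : realType} {Omega : topologicalType}.
Implicit Types (d rho : Omega -> Omega -> R) (T : Omega -> Omega) (e : R).

Definition is_metric d : Prop :=
  [/\ forall x y, 0 <= d x y,
      forall x y, d x y = 0 <-> x = y,
      forall x y, d x y = d y x &
      forall x y z, d x z <= d x y + d y z].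

Definition induces_topology d : Prop :=
  forall U : set Omega,
    open U <-> forall x, U x -> exists2 r, 0 < r & [set y | d x y < r] `<=` U.

Definition compatible_metrics : set (Omega -> Omega -> R) :=
  [set d | is_metric d /\ induces_topology d].

Definition eps_separated rho e (S : set Omega) : Prop :=
  forall x y, S x -> S y -> x <> y -> e <= rho x y.

(* A supremum over finite separated sets: [+oo] exactly when their
   cardinalities are unbounded (which compactness rules out when [0 < e]). *)
Definition separation_number rho e : \bar R :=
  ereal_sup [set m%:R%:E | m in
    [set m : nat | exists S : set Omega,
      eps_separated rho e S /\ (S #= `I_m)%card]].

(* The seed 0 does not change the maximum, since metrics are nonnegative. *)
Definition bowen_metric d T (n : nat) (x y : Omega) : R :=
  \big[Num.max/0]_(k < n) d (iter k T x) (iter k T y).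

Definition mdimM_rel T d : \bar R :=
  limf_einf (fun e : R =>
    limn_esup (fun n : nat =>
      (lne (separation_number (bowen_metric d T n) e)
        / (n%:R * ln (1 / e))%:E)%E))
    0^'+.

Definition upper_minkowski_dim d : \bar R :=
  limf_esup (fun e : R =>
    (lne (separation_number d e) / (ln (1 / e))%:E)%E)
    0^'+.

End Metrics.

Definition mdimM (R : realType) (Omega : topologicalType)
    (T : Omega -> Omega) : \bar R :=
  ereal_inf [set mdimM_rel T d | d in @compatible_metrics R Omega].

(* Main.v *)
(* The metric is d(x, y) = |h x - h y| for an increasing homeomorphism h of
   [0, 1], so that ([0, 1], d) is isometric to [0, 1] and has Minkowski dimension
   1; it remains to choose h so that T slows down at scales 1/E tending to 0.
   At such a scale, h varies by less than 1/E outside M tiny intervals, where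
   log M is negligible against log E. Recording which interval or gap an orbit
   visits costs O(log M) per unit of time; the position inside an interval costs
   log E, but it has to be recorded only once every L steps: the intervals are
   chosen so that either T^(L!) is the identity on them, and the orbit is
   periodic once it enters, or points of any of them need at least L steps to
   reach any of them again. Hence log N(n) / (n log E) = O(1/L). Passing from h
   to (1 - s) (h o phi) + s h, where phi squeezes the increase into the
   intervals, changes h little once M is large, and the bound at scale 1/E
   survives small perturbations of h, so h is obtained as a uniform limit with L
   tending to infinity. *)
Require Import Defs.
From mathcomp Require Import all_boot all_order all_algebra.
From mathcomp Require Import all_classical all_reals all_analysis.
From mathcomp Require Import zify ring lra.

Set Implicit Arguments.
Unset Strict Implicit.
Unset Printing Implicit Defensive.

Import Order.TTheory GRing.Theory Num.Theory.
Import numFieldNormedType.Exports.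

Local Open Scope classical_set_scope.
Local Open Scope ring_scope.

(** * Symbolic coding of orbits *)

Lemma iter_mod_period (X : Type) (F : X -> X) (q k : nat) (y : X) :
  iter q F y = y -> iter k F y = iter (k %% q) F y.
Proof.
move=> Fq; rewrite {1}(divn_eq k q) addnC iterD; congr iter.
by elim: (k %/ q)%N => // j IH; rewrite mulSn iterD IH.
Qed.

Lemma find_uniq (p : pred nat) (L k : nat) :
  (k < L)%N -> p k -> (forall i, (i < L)%N -> p i -> i = k) ->
  find p (iota 0 L) = k.
Proof.
move=> kL pk uk.
have hp : has p (iota 0 L) by apply/hasP; exists k => //; rewrite mem_iota.
have fL : (find p (iota 0 L) < L)%N by move: hp; rewrite has_find size_iota.
by apply: uk => //; have := nth_find 0%N hp; rewrite nth_iota.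
Qed.

(* An orbit segment of length n is determined, up to closeness at each time, by
   its symbols, one cell per block of L times (visits to V1 are L apart), and
   the q cells following the first visit to V2 (periodic from then on). *)
Lemma card_separated_orbits (X : Type) (F : X -> X) (A : finType)
    (sym : X -> A) (V1 V2 : pred A) (K L q : nat) (cell : X -> 'I_K)
    (close : X -> X -> Prop) (n m : nat) (x : 'I_m -> X) :
  (0 < L)%N -> (0 < q)%N ->
  (forall y i, (0 < i < L)%N -> V1 (sym y) -> ~~ V1 (sym (iter i F y))) ->
  (forall y, V2 (sym y) -> iter q F y = y) ->
  (forall y z, sym y = sym z -> ~~ V1 (sym y) -> ~~ V2 (sym y) -> close y z) ->
  (forall y z, cell y = cell z -> close y z) ->
  (forall i j, i != j ->
    exists2 t, (t < n)%N & ~ close (iter t F (x i)) (iter t F (x j))) ->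
  (m <= #|A| ^ n * K ^ ((n %/ L).+1 + q))%N.
Proof.
move=> L0 q0 sparse per gap cellP sep.
pose s y t := sym (iter t F y).
(* In a block without a visit to [V1], [find] returns [L], and the cell recorded there is never
   consulted. Likewise [start] is [n] when [V2] is not met before time [n]. *)
pose visit y b := (b * L + find (fun i => V1 (s y (b * L + i)%N)) (iota 0 L))%N.
pose start y := find (fun t => V2 (s y t)) (iota 0 n).
pose code y := ([ffun t : 'I_n => s y t],
  [ffun b : 'I_(n %/ L).+1 => cell (iter (visit y b) F y)],
  [ffun r : 'I_q => cell (iter (start y + r) F y)]).
have visitE y t : V1 (s y t) -> visit y (t %/ L)%N = t.
  move=> Vt; rewrite /visit [RHS](divn_eq t L); congr addn.
  apply: find_uniq; rewrite ?ltn_mod -?divn_eq// => i iL Vi.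
  have := divn_eq t L; set b := (t %/ L)%N in Vi *; set r := (t %% L)%N => tE.
  have rL : (r < L)%N by rewrite ltn_mod.
  (* Two distinct [V1] visits in one block would be less than [L] apart, against [sparse] applied at
     the earlier one. *)
  case: (ltngtP i r) => // ir.
  - have := sparse (iter (b * L + i) F y) (r - i)%N.
    rewrite -iterD (_ : (r - i + (b * L + i) = t)%N); last by lia.
    rewrite -/(s y t) Vt /= => absurd; suff: false by [].
    by apply: absurd => //; lia.
  - have := sparse (iter t F y) (i - r)%N.
    rewrite -iterD (_ : (i - r + t = b * L + i)%N); last by lia.
    rewrite -/(s y _) Vi /= => absurd; suff: false by [].
    by apply: absurd => //; lia.
have codeP y z : code y = code z ->
    forall t, (t < n)%N -> close (iter t F y) (iter t F z).
  move=> [/ffunP eqs /ffunP eqv /ffunP eqt] t tn.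
  have sE k : (k < n)%N -> s y k = s z k.
    by move=> kn; have := eqs (Ordinal kn); rewrite !ffunE.
  (* Three cases: at a [V1] visit the block's cell is read; if neither [V1] at [t] nor [V2] up to
     [t] is visited, the symbol alone suffices; after a [V2] visit the periodic tail is used. *)
  have [V1t|V1t] := boolP (V1 (s y t)).
    have tb : (t %/ L < (n %/ L).+1)%N by rewrite ltnS leq_div2r // ltnW.
    have := eqv (Ordinal tb); rewrite !ffunE /= !visitE -?sE//.
    exact: cellP.
  have [hasV|noV] := boolP (has (fun k => V2 (s y k)) (iota 0 t.+1)); last first.
    apply: gap; rewrite -?/(s _ _) -?sE//.
    by apply: contra noV => V2t; apply/hasP; exists t; rewrite // mem_iota /=.
  have startE : start y = start z.
    by apply: eq_in_find => k; rewrite mem_iota /= => kn; rewrite sE.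
  have [k] := hasP hasV; rewrite mem_iota add0n ltnS => /andP[_ kt] V2k.
  have hn : has (fun k => V2 (s y k)) (iota 0 n).
    by apply/hasP; exists k; rewrite // mem_iota /=; lia.
  have sn : (start y < n)%N by move: hn; rewrite has_find size_iota.
  have V2s : V2 (s y (start y)).
    by have := nth_find 0%N hn; rewrite nth_iota// -/(start y); apply: sn.
  have st : (start y <= t)%N.
    rewrite (leq_trans _ kt)// leqNgt; apply/negP => lt.
    have := before_find 0%N lt; rewrite nth_iota; last exact: ltn_trans sn.
    by rewrite V2k.
  (* Periodicity from [start y] on reduces time [t] to one of the [q] recorded positions. *)
  have tailE w : V2 (s w (start y)) ->
      iter t F w = iter (start y + (t - start y) %% q) F w.
    move=> V2w; rewrite -{1}(subnK st) iterD (iter_mod_period _ (per _ V2w)).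
    by rewrite -iterD addnC.
  rewrite !tailE -?sE//; apply: cellP.
  have rq : ((t - start y) %% q < q)%N by rewrite ltn_mod.
  by have := eqt (Ordinal rq); rewrite !ffunE /= startE.
have inj : injective (code \o x).
  move=> i j /codeP cl; apply/eqP; apply: contraT => /sep[t tn].
  by case; apply: cl.
have := leq_card _ inj.
by rewrite !card_prod !card_ffun !card_ord -mulnA -expnD.
Qed.

(** * Shrinking families of intervals *)

Definition refines (R : realType) (I : Type) (a' b' a b : I -> R) : Prop :=
  forall k, [/\ a k <= a' k, a' k < b' k & b' k <= b k].

Lemma refines_trans (R : realType) (I : Type) (a2 b2 a1 b1 a b : I -> R) :
  refines a2 b2 a1 b1 -> refines a1 b1 a b -> refines a2 b2 a b.
Proof. by move=> h2 h1 k; case: (h2 k) (h1 k) => ? ? ? [? ? ?]; split; lra. Qed.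

Lemma refines_around (R : realType) (I : Type) (a b p : I -> R) (r : R) :
  0 < r -> (forall k, a k < b k) -> (forall k, a k <= p k <= b k) ->
  exists a' b', refines a' b' a b /\
    forall k x, a' k <= x <= b' k -> `|x - p k| <= r.
Proof.
move=> r0 ab pab.
exists (fun k => Num.max (a k) (p k - r)), (fun k => Num.min (b k) (p k + r)).
split=> k => [|x].
  have /andP[ap pb] := pab k; have abk := ab k; split.
  - by rewrite le_max lexx.
  - by rewrite lt_min !gt_max; apply/andP; split; apply/andP; split; lra.
  - by rewrite ge_min lexx.
rewrite ge_max le_min => /andP[/andP[_ ?] /andP[_ ?]].
by rewrite ler_norml; apply/andP; split; lra.
Qed.

(** Shrink around the points [p] until, by continuity, images of box [j] stay within a third of the
    gap from [G (p j)] and box [l] within a third of it from [p l]. The case [j = l] is included. *)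
Lemma refines_separate (R : realType) (I : Type) (G : R -> R) (a b p : I -> R)
    (j l : I) :
  continuous G -> (forall k, a k < b k) -> (forall k, a k <= p k <= b k) ->
  G (p j) != p l ->
  exists a' b', refines a' b' a b /\
    forall x y, a' j <= x <= b' j -> a' l <= y <= b' l -> G x != y.
Proof.
move=> cG ab pab Gp; pose e := `|G (p j) - p l| / 3.
have e0 : 0 < e by rewrite divr_gt0// normr_gt0 subr_eq0.
have /cvgrPdist_lt/(_ e e0)/nbhs_ballP[r /= r0 rP] := cG (p j).
have [|a' [b' [ref near_p]]] := @refines_around R I a b p (Num.min (r / 2) e) _ ab pab.
  by rewrite lt_min e0 andbT divr_gt0.
exists a', b'; split=> // x y xj yl; apply/eqP => Gxy.
have := near_p _ _ xj; have := near_p _ _ yl; rewrite !le_min => /andP[_ y1] /andP[x1 _].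
have /rP/= : ball (p j) r x.
  by rewrite /ball /= distrC (le_lt_trans x1)// gtr_pMr ?invf_lt1 ?ltr1n.
rewrite Gxy => lt1.
have := ler_distD y (G (p j)) (p l); move: y1 lt1 e0; rewrite /e; lra.
Qed.

Lemma continuous_iter (U : topologicalType) (F : U -> U) (i : nat) :
  continuous F -> continuous (iter i F).
Proof.
move=> cF; elim: i => [|i IH] x; first exact: cvg_id.
exact: (continuous_comp (IH x) (cF _)).
Qed.

(** Triples are treated one at a time, and further refinement preserves separations already
    obtained. For [j <> l] the two points are chosen independently, so the hypothesis concerns
    diagonal triples only; it ranges over all subintervals in order to survive refinement. *)
Lemma refines_separate_iter (R : realType) (I : eqType) (F : R -> R)
    (a b : I -> R) (s : seq (I * nat * I)) :
  continuous F -> (forall k, a k < b k) ->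
  (forall j i, (j, i, j) \in s -> forall c e, a j <= c -> c < e -> e <= b j ->
    exists2 x, c <= x <= e & iter i F x != x) ->
  exists a' b', refines a' b' a b /\
    forall j i l, (j, i, l) \in s ->
      forall x y, a' j <= x <= b' j -> a' l <= y <= b' l -> iter i F x != y.
Proof.
move=> cF ab; elim: s => [|[[j i] l] s IH] nonper.
  by exists a, b; split=> // k; split.
have [|a1 [b1 [ref1 sep1]]] := IH.
  by move=> j' i' js; apply: nonper; rewrite inE js orbT.
have ab1 k : a1 k < b1 k by case: (ref1 k).
have [p [pab Gp]] : exists p : I -> R, (forall k, a1 k <= p k <= b1 k) /\
    iter i F (p j) != p l.
  have [jl|jl] := eqVneq j l.
    case: (ref1 j) => aj abj bj.
    have [|x xj Fx] := nonper j i _ _ _ aj abj bj; first by rewrite jl inE eqxx.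
    exists (fun k => if k == j then x else a1 k); split=> [k|].
      by case: eqP => [->|_] //; rewrite lexx ltW.
    by rewrite -jl eqxx.
  (* The endpoints of box [l] are distinct, so one of them is not the image of [a1 j]. *)
  pose y := if iter i F (a1 j) == a1 l then b1 l else a1 l.
  exists (fun k => if k == l then y else a1 k); split=> [k|].
    case: eqP => [->|_]; rewrite ?lexx ?(ltW (ab1 _))//.
    by rewrite /y; case: ifP => _; rewrite ?lexx ?(ltW (ab1 _)).
  rewrite (negPf jl) eqxx /y; case: ifP => [/eqP->|->] //.
  by rewrite lt_eqF.
have [a2 [b2 [ref2 sep2]]] := refines_separate (continuous_iter cF) ab1 pab Gp.
exists a2, b2; split; first exact: refines_trans ref2 ref1.
move=> j' i' l'; rewrite inE => /orP[/eqP[-> -> ->]|js] //.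
move=> x y /andP[x1 x2] /andP[y1 y2]; apply: (sep1 _ _ _ js).
  by case: (ref2 j') => ? ? ?; apply/andP; split; lra.
by case: (ref2 l') => ? ? ?; apply/andP; split; lra.
Qed.

(* A box in which iter L`! F is the identity on some subinterval is shrunk to
   that subinterval (predicate per). In the other boxes no iterate of order
   below L fixes a subinterval, so successive shrinking can move every such
   iterate off them. *)
Lemma sparse_intervals (R : realType) (I : finType) (F : R -> R) (L : nat)
    (a b : I -> R) :
  continuous F -> (forall k, a k < b k) ->
  exists a' b' (per : pred I),
    [/\ refines a' b' a b,
        forall j x, per j -> a' j <= x <= b' j -> iter L`! F x = x &
        forall j l i x, ~~ per j -> ~~ per l -> (0 < i < L)%N ->
          a' j <= x <= b' j -> ~~ (a' l <= iter i F x <= b' l)].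
Proof.
move=> cF ab.
pose isper j (ce : R * R) := [/\ a j <= ce.1, ce.1 < ce.2, ce.2 <= b j &
  forall x, ce.1 <= x <= ce.2 -> iter L`! F x = x].
pose per j := `[< exists ce, isper j ce >].
have /choice[ce ceP] : forall j, exists ce, if per j then isper j ce
    else ce = (a j, b j).
  move=> j; have [/asboolP[ce ceP]|_] := boolP (per j); last by exists (a j, b j).
  by exists ce.
pose a1 j := (ce j).1; pose b1 j := (ce j).2.
have ref1 : refines a1 b1 a b.
  by move=> k; have := ceP k; rewrite /a1 /b1; case: ifP => [_ []|_ ->] //=.
have ab1 k : a1 k < b1 k by case: (ref1 k).
pose s := [seq (t.1.1, nat_of_ord t.1.2, t.2) |
  t : I * 'I_L * I <- enum {: I * 'I_L * I} &
  [&& ~~ per t.1.1, ~~ per t.2 & (0 < t.1.2)%N]].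
have [|a2 [b2 [ref2 sep]]] := @refines_separate_iter R I F a1 b1 s cF ab1.
  move=> j i /mapP[[[j1 i1] l1]]; rewrite mem_filter /= => /andP[/and3P[nj _ i0] _].
  case=> -> -> _ c e ac ce' eb; apply: contrapT => none.
  suff: per j1 by apply/negP.
  (* A subinterval fixed pointwise by the iterate of order [i1 < L] is fixed by the one of order L!,
     since [i1] divides L!; the box would then be periodic. *)
  apply/asboolP; exists (c, e).
  have [ac0 _ eb0] := ref1 j1; split=> /=; [lra|lra|lra|].
  move=> x xce; have Fi : iter i1 F x = x.
    by apply/eqP; apply: contrapT => /negP Fx; apply: none; exists x.
  suff dv : (i1 %| L`!)%N by rewrite (iter_mod_period (L`!)%N Fi) (eqP dv).
  by rewrite dvdn_fact// i0 ltnW.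
exists a2, b2, per; split; first exact: refines_trans ref2 ref1.
  move=> j x pj /andP[x1 x2]; have := ceP j; rewrite pj => -[_ _ _]; apply.
  by have [? ? ?] := ref2 j; apply/andP; split; rewrite -/(a1 j) -/(b1 j); lra.
move=> j l i x nj nl /andP[i0 iL] xj; apply/negP => xl.
have /sep/(_ x (iter i F x) xj xl) : (j, i, l) \in s.
  apply/mapP; exists (j, Ordinal iL, l) => //.
  by rewrite mem_filter /= nj nl i0 mem_enum.
by rewrite eqxx.
Qed.

(** * The squeezing map *)

Definition ramp (R : realType) (a b x : R) : R :=
  Num.max 0 (Num.min 1 ((x - a) / (b - a))).

Lemma ramp_itv (R : realType) (a b x : R) : 0 <= ramp a b x <= 1.
Proof. by rewrite /ramp le_max lexx /= ge_max ler01 ge_min lexx. Qed.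

Lemma ramp_eq0 (R : realType) (a b x : R) : a < b -> x <= a -> ramp a b x = 0.
Proof.
move=> ab xa; apply/max_l; rewrite ge_min; apply/orP; right.
by rewrite pmulr_lle0 ?invr_gt0; lra.
Qed.

Lemma ramp_eq1 (R : realType) (a b x : R) : a < b -> b <= x -> ramp a b x = 1.
Proof.
move=> ab bx; rewrite /ramp min_l ?max_r// ler_pdivlMr; lra.
Qed.

Lemma ramp_lip (R : realType) (a b x y : R) : a < b -> x <= y ->
  0 <= ramp a b y - ramp a b x <= (b - a)^-1 * (y - x).
Proof.
move=> ab xy; rewrite /ramp !minElt !maxElt.
have c0 : 0 < (b - a)^-1 by rewrite invr_gt0; lra.
have cxy : 0 <= (b - a)^-1 * (y - x) by rewrite mulr_ge0; lra.
have -> : (y - a) / (b - a) = (x - a) / (b - a) + (b - a)^-1 * (y - x) by ring.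
move: cxy; set u := (x - a) / _; set v := _ * (y - x) => v0.
by do !case: ifPn; rewrite -?leNgt => *; apply/andP; split; lra.
Qed.

(* Each slot [j/M, (j+1)/M] of [0, 1] is squeezed into its subinterval
   [a j, b j], where all the increase takes place. *)
Definition squeeze (R : realType) (M : nat) (a b : 'I_M -> R) (x : R) : R :=
  M%:R^-1 * \sum_(j < M) ramp (a j) (b j) x.

Definition slotted (R : realType) (M : nat) (a b : 'I_M -> R) : Prop :=
  forall j : 'I_M, [/\ j%:R / M%:R <= a j, a j < b j & b j <= j.+1%:R / M%:R].

Lemma sum_ltn_ord (k M : nat) : (\sum_(j < M) (j < k) = minn k M)%N.
Proof.
elim: M => [|M IH]; first by rewrite big_ord0 minn0.
by rewrite big_ord_recr /= IH; case: ltnP => ? /=; lia.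
Qed.

(** If [x] lies in slot [k], the ramps of earlier slots are full and those of later slots vanish, so
    the sum of the ramps lies in [[k, k+1]], as does [M * x]. *)
Lemma squeeze_near (R : realType) (M : nat) (a b : 'I_M -> R) (x : R) :
  (0 < M)%N -> slotted a b -> 0 <= x <= 1 ->
  0 <= squeeze a b x <= 1 /\ `|squeeze a b x - x| <= M%:R^-1.
Proof.
move=> M0 sl /andP[x0 x1]; rewrite /squeeze.
have MR : 0 < M%:R :> R by rewrite ltr0n.
have sum_ind k : (k <= M)%N -> \sum_(j < M) (j < k)%N%:R = k%:R :> R.
  by move=> kM; rewrite -natr_sum sum_ltn_ord (minn_idPl kM).
(* The slot is given by the integer part of [M * x], except that [x = 1] is put in the last slot, of
   index [M - 1]. *)
have [k kM /andP[kx xk]] : exists2 k, (k < M)%N & k%:R <= M%:R * x <= k.+1%:R.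
  have [x1'|x1'] := ltP x 1; last first.
    exists M.-1; rewrite ?prednK// ?ltn_predL//.
    have -> : x = 1 by lra.
    by rewrite mulr1 lexx ler_nat leq_pred.
  have /truncn_itv/andP[h1 h2] : 0 <= M%:R * x by rewrite mulr_ge0.
  exists (Num.truncn (M%:R * x)); last by rewrite h1 ltW.
  by rewrite -(ltr_nat R); apply: le_lt_trans h1 _; rewrite gtr_pMr.
have lo : k%:R <= \sum_(j < M) ramp (a j) (b j) x.
  rewrite -(sum_ind k) ?(ltnW kM)//; apply: ler_sum => j _.
  have /andP[r0 r1] := ramp_itv (a j) (b j) x.
  case: ltnP => // jk; have [_ abj bj] := sl j.
  rewrite ramp_eq1//; apply: le_trans bj _.
  rewrite ler_pdivrMr// mulrC; apply: le_trans kx; by rewrite ler_nat.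
have hi : \sum_(j < M) ramp (a j) (b j) x <= k.+1%:R.
  rewrite -(sum_ind k.+1)//; apply: ler_sum => j _.
  have /andP[r0 r1] := ramp_itv (a j) (b j) x.
  case: ltnP => // jk; have [aj abj _] := sl j.
  rewrite ramp_eq0//; apply: le_trans aj.
  rewrite ler_pdivlMr// mulrC; apply: le_trans xk _; by rewrite ler_nat.
set S := \sum_(_ < _) _ in lo hi *.
have SM : S <= M%:R by apply: le_trans hi _; rewrite ler_nat.
have S0 : 0 <= S by apply: le_trans lo.
split.
  by rewrite ler_pdivrMl// mulr1 SM andbT mulr_ge0// invr_ge0 ltW.
have -> : M%:R^-1 * S - x = M%:R^-1 * (S - M%:R * x) by field; rewrite gt_eqF.
rewrite normrM gtr0_norm ?invr_gt0// ger_pMr ?invr_gt0//.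
rewrite ler_norml; move: kx xk hi lo; rewrite -natr1; lra.
Qed.

Lemma squeeze0 (R : realType) (M : nat) (a b : 'I_M -> R) :
  slotted a b -> squeeze a b 0 = 0.
Proof.
move=> sl; rewrite /squeeze big1 ?mulr0// => j _; have [aj ab _] := sl j.
by rewrite ramp_eq0//; apply: le_trans aj; rewrite divr_ge0.
Qed.

Lemma squeeze1 (R : realType) (M : nat) (a b : 'I_M -> R) :
  (0 < M)%N -> slotted a b -> squeeze a b 1 = 1.
Proof.
move=> M0 sl; rewrite /squeeze (eq_bigr (fun=> 1)).
  by rewrite sumr_const card_ord mulVf// pnatr_eq0 -lt0n.
move=> j _; have [_ ab bj] := sl j; rewrite ramp_eq1//; apply: le_trans bj _.
by rewrite ler_pdivrMr ?mul1r ?ler_nat ?ltr0n.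
Qed.

Lemma squeeze_lip (R : realType) (M : nat) (a b : 'I_M -> R) :
  slotted a b -> exists2 l : R, 0 <= l &
    forall x y, x <= y -> 0 <= squeeze a b y - squeeze a b x <= l * (y - x).
Proof.
move=> sl; have ab j : a j < b j by case: (sl j).
exists (M%:R^-1 * \sum_(j < M) (b j - a j)^-1).
  by rewrite mulr_ge0 ?invr_ge0// sumr_ge0// => j _; rewrite invr_ge0; have := ab j; lra.
move=> x y xy; rewrite /squeeze -mulrBr -sumrB -mulrA mulr_suml.
apply/andP; split.
  rewrite mulr_ge0 ?invr_ge0// sumr_ge0// => j _.
  by case/andP: (ramp_lip (ab j) xy).
rewrite ler_wpM2l ?invr_ge0//; apply: ler_sum => j _.
by case/andP: (ramp_lip (ab j) xy).
Qed.

(** Outside all the intervals each ramp equals 0 or 1, according to the side on which the point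
    lies. *)
Lemma squeeze_gap (R : realType) (M : nat) (a b : 'I_M -> R) (x y : R) :
  slotted a b ->
  (forall j, (a j <= x) = (a j <= y) /\ (x <= b j) = (y <= b j)) ->
  (forall j, ~~ (a j <= x <= b j)) -> squeeze a b x = squeeze a b y.
Proof.
move=> sl same gap; rewrite /squeeze; congr (_ * _); apply: eq_bigr => j _.
have [_ ab _] := sl j; have [ea eb] := same j; have := gap j.
rewrite negb_and => /orP[na|nb].
  have := na; rewrite ea -!ltNge => na'; rewrite -ltNge in na.
  by rewrite !ramp_eq0// ltW.
have := nb; rewrite eb -!ltNge => nb'; rewrite -ltNge in nb.
by rewrite !ramp_eq1// ltW.
Qed.

(** * Counting separated orbits at one scale *)

Definition pullback_metric (R : realType) (h : R -> R) (x y : I01 R) : R :=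
  `|h (set_val x) - h (set_val y)|.

Lemma I01_itv (R : realType) (x : I01 R) : 0 <= set_val x <= 1.
Proof. by have := set_valP x; rewrite /= in_itv. Qed.

Lemma bowen_metric_ge (R : realType) (U : topologicalType) (d : U -> U -> R)
    (T : U -> U) (n : nat) (e : R) (x y : U) :
  0 < e -> e <= bowen_metric d T n x y ->
  exists2 t, (t < n)%N & e <= d (iter t T x) (iter t T y).
Proof.
move=> e0; apply: contraPP => none; apply/negP; rewrite -ltNge.
apply: bigmax_lt => // t _; rewrite ltNge; apply/negP => le.
by apply: none; exists t.
Qed.

Lemma truncn_eq_near (R : realType) (c u v : R) :
  0 < c -> 0 <= u -> 0 <= v ->
  Num.truncn (c * u) = Num.truncn (c * v) -> `|u - v| < c^-1.
Proof.
move=> c0 u0 v0 uv.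
have /truncn_itv/andP[u1 u2] : 0 <= c * u by rewrite mulr_ge0// ltW.
have /truncn_itv/andP[v1 v2] : 0 <= c * v by rewrite mulr_ge0// ltW.
rewrite -[X in _ < X]mul1r ltr_pdivlMr// -(gtr0_norm c0) -normrM ltr_norml.
move: u1 u2; rewrite uv; move: v1 v2; rewrite -!natr1.
by move=> *; apply/andP; split; lra.
Qed.

Lemma truncn_mul_le (R : realType) (c u : R) :
  0 <= c -> 0 <= u <= 1 -> (Num.truncn (c * u) <= Num.truncn c)%N.
Proof. by move=> c0 /andP[u0 u1]; apply: le_truncn; rewrite ler_piMr. Qed.

(** The symbol of a point consists of two comparisons per slot, hence [4 ^ M] symbols; its cell is
    the integer part of [E * g], hence [E + 1] cells, and points of one cell are less than [1/E]
    apart. *)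
Lemma separated_orbits_slots (R : realType) (T : I01 R -> I01 R) (M L E q : nat)
    (a b : 'I_M -> R) (per : pred 'I_M) (g : R -> R) (n m : nat)
    (x : 'I_m -> I01 R) :
  (0 < L)%N -> (0 < q)%N -> (0 < E)%N ->
  (forall j (y : I01 R), per j -> a j <= set_val y <= b j -> iter q T y = y) ->
  (forall j l i (y : I01 R), ~~ per j -> ~~ per l -> (0 < i < L)%N ->
    a j <= set_val y <= b j -> ~~ (a l <= set_val (iter i T y) <= b l)) ->
  (forall y : R, 0 <= y <= 1 -> 0 <= g y <= 1) ->
  (forall y z : R, 0 <= y <= 1 -> 0 <= z <= 1 ->
    (forall j, (a j <= y) = (a j <= z) /\ (y <= b j) = (z <= b j)) ->
    (forall j, ~~ (a j <= y <= b j)) -> `|g y - g z| < E%:R^-1) ->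
  (forall i j, i != j ->
    E%:R^-1 <= bowen_metric (pullback_metric g) T n (x i) (x j)) ->
  (m <= (4 ^ M) ^ n * E.+1 ^ ((n %/ L).+1 + q))%N.
Proof.
move=> L0 q0 E0 perq sparse g01 gap sep.
pose sym (y : I01 R) := [ffun j : 'I_M => (a j <= set_val y, set_val y <= b j)].
pose V (P : pred 'I_M) (s : {ffun 'I_M -> bool * bool}) :=
  [exists j, P j && ((s j).1 && (s j).2)].
have VP (P : pred 'I_M) (y : I01 R) :
    reflect (exists2 j, P j & a j <= set_val y <= b j) (V P (sym y)).
  apply: (iffP existsP) => [[j]|[j Pj yj]].
    by rewrite ffunE /= => /andP[Pj yj]; exists j.
  by exists j; rewrite ffunE /= Pj.
pose cell (y : I01 R) : 'I_E.+1 := inord (Num.truncn (E%:R * g (set_val y))).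
have <- : #|{ffun 'I_M -> bool * bool}| = (4 ^ M)%N.
  by rewrite card_ffun card_prod card_bool card_ord.
apply: (@card_separated_orbits _ T _ sym (V (fun j => ~~ per j)) (V per) _ L q
  cell (fun y z => pullback_metric g y z < E%:R^-1) n m x) => //.
- move=> y i iL /VP[j nj yj]; apply/negP => /VP[l nl yl].
  by have := sparse _ _ _ _ nj nl iL yj; rewrite yl.
- by move=> y /VP[j pj yj]; apply: perq yj.
- move=> y z /ffunP yz /VP n1 /VP n2; apply: gap; rewrite ?I01_itv// => j.
    by have := yz j; rewrite !ffunE => -[-> ->].
  apply/negP => yj; case: (boolP (per j)) => pj; first by apply: n2; exists j.
  by apply: n1; exists j.
- have g0 (y : I01 R) : 0 <= g (set_val y) <= 1 by apply: g01; exact: I01_itv.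
  have cE (y : I01 R) : cell y = Num.truncn (E%:R * g (set_val y)) :> nat.
    by rewrite inordK// ltnS (leq_trans (truncn_mul_le _ (g0 y)))// natrK.
  move=> y z /(congr1 val); rewrite /= !cE.
  by apply: truncn_eq_near; rewrite ?ltr0n//; case/andP: (g0 y) (g0 z) => [? _] /andP[].
- move=> i j /sep/bowen_metric_ge[|t tn le]; first by rewrite invr_gt0 ltr0n.
  by exists t => //; apply/negP; rewrite -leNgt.
Qed.

(** After raising to the power [L], the symbols contribute at most [E ^ n]. Since [E + 1 <= E ^ 2],
    the cells contribute exponent at most [2 n + 2 L + 2 L q <= 3 n]. *)
Lemma slot_count_bound (M L E q n m : nat) :
  (1 < E)%N -> ((4 ^ M) ^ L <= E)%N -> (2 * L + 2 * (L * q) <= n)%N ->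
  (m <= (4 ^ M) ^ n * E.+1 ^ ((n %/ L).+1 + q))%N -> (m ^ L <= E ^ (4 * n))%N.
Proof.
move=> E1 AE nL mle.
have E2 : (E.+1 <= E ^ 2)%N by rewrite expnS expn1; nia.
case: L AE nL mle => [|L] AE nL mle; first by rewrite expn0 expn_gt0 ltnW.
apply: (@leq_trans (((4 ^ M) ^ n * E.+1 ^ ((n %/ L.+1).+1 + q)) ^ L.+1)%N).
  by rewrite leq_exp2r.
apply: (@leq_trans (E ^ n * (E ^ 2) ^ (((n %/ L.+1).+1 + q) * L.+1))%N).
  rewrite expnMn leq_mul//.
    by rewrite -expnM mulnC expnM; case: n {nL mle} => // n; rewrite leq_exp2r.
  by rewrite -expnM; set k := (_ * L.+1)%N; case: k => // k; rewrite leq_exp2r.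
rewrite -expnM -expnD leq_exp2l//.
have := leq_trunc_div n L.+1; nia.
Qed.

(** * Bi-Lipschitz homeomorphisms of [0, 1] *)

(** The slopes [s] and [l] are existential: they may degenerate along the construction, each step
    using only those of the maps at hand. *)
Definition bilipschitz_homeo (R : realType) (h : R -> R) : Prop :=
  [/\ h 0 = 0, h 1 = 1 & exists s l : R, [/\ 0 < s, 0 <= l &
    forall x y, 0 <= x -> x <= y -> y <= 1 ->
      s * (y - x) <= h y - h x <= l * (y - x)]].

Lemma bilipschitz_itv (R : realType) (h : R -> R) (x : R) :
  bilipschitz_homeo h -> 0 <= x <= 1 -> 0 <= h x <= 1.
Proof.
move=> [h0 h1 [s [l [s0 l0 hP]]]] /andP[x0 x1].
have /andP[+ _] := hP 0 x (lexx _) x0 x1.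
have /andP[+ _] := hP x 1 x0 x1 (lexx _).
have : 0 <= s * (1 - x) by rewrite mulr_ge0; lra.
have : 0 <= s * (x - 0) by rewrite mulr_ge0; lra.
by rewrite h0 h1 => *; apply/andP; split; lra.
Qed.

(** The composite of [h] with [squeeze] is flat off the intervals, so the positive lower slope is
    supplied by the term [s * h x]. *)
Lemma bilipschitz_squeeze (R : realType) (h : R -> R) (M : nat)
    (a b : 'I_M -> R) (s : R) :
  (0 < M)%N -> slotted a b -> bilipschitz_homeo h -> 0 < s < 1 ->
  bilipschitz_homeo (fun x => (1 - s) * h (squeeze a b x) + s * h x).
Proof.
move=> M0 sl [h0 h1 [c [l [c0 l0 hP]]]] /andP[s0 s1].
split; rewrite ?squeeze0 ?squeeze1// ?h0 ?h1; [ring|ring|].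
have [k k0 kP] := squeeze_lip sl.
exists (s * c), (l * k + l); split; first exact: mulr_gt0.
  by rewrite addr_ge0// mulr_ge0.
move=> x y x0 xy y1; have /andP[q1 q2] := kP _ _ xy.
have [|/andP[sx _] _] := squeeze_near (x := x) M0 sl.
  by apply/andP; split; lra.
have [|/andP[_ sy] _] := squeeze_near (x := y) M0 sl.
  by apply/andP; split; lra.
have /andP[p1 p2] := hP _ _ x0 xy y1.
have sxy : squeeze a b x <= squeeze a b y by lra.
have /andP[r1 r2] := hP _ _ sx sxy sy.
move: r1 r2; set u := h (squeeze _ _ y) in p1 p2 *.
set v := h (squeeze _ _ x) in p1 p2 * => r1 r2.
have r0 : 0 <= u - v by apply: le_trans r1; rewrite mulr_ge0// ltW.
have r3 : u - v <= l * k * (y - x).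
  by apply: le_trans r2 _; rewrite -mulrA ler_wpM2l.
have yx : 0 <= y - x by lra.
have lk : 0 <= l * k * (y - x) by rewrite !mulr_ge0.
have -> : (1 - s) * u + s * h y - ((1 - s) * v + s * h x) =
  (1 - s) * (u - v) + s * (h y - h x) by ring.
have m1 : 0 <= (1 - s) * (u - v) by rewrite mulr_ge0//; lra.
have m2 : s * (c * (y - x)) <= s * (h y - h x) by rewrite ler_pM2l.
have m3 : s * (h y - h x) <= 1 * (l * (y - x)).
  apply: ler_pM; [lra| |lra|exact: p2].
  by apply: le_trans p1; rewrite mulr_ge0// ltW.
have m4 : (1 - s) * (u - v) <= 1 * (l * k * (y - x)).
  by apply: ler_pM; [lra|exact: r0|lra|exact: r3].
by apply/andP; split; lra.
Qed.

(** * Extending self-maps of [0, 1] to the line *)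

Lemma clamp01_itv (R : realType) (x : R) :
  Num.max 0 (Num.min 1 x) \in (`[0, 1]%classic : set R).
Proof. by rewrite inE /= in_itv /= le_max lexx ge_max ler01 ge_min lexx. Qed.

Definition proj01 (R : realType) (x : R) : I01 R := SigSub (clamp01_itv x).

Lemma set_val_proj01 (R : realType) (x : R) :
  0 <= x <= 1 -> set_val (proj01 x) = x.
Proof.
move=> /andP[x0 x1]; have -> : set_val (proj01 x) = Num.max 0 (Num.min 1 x) by [].
by rewrite min_r// max_r.
Qed.

Lemma proj01K (R : realType) (x : I01 R) : proj01 (set_val x) = x.
Proof.
by apply: val_inj; apply: set_val_proj01; apply: I01_itv.
Qed.

Lemma continuous_set_val (R : realType) : continuous (set_val : I01 R -> R).
Proof. exact: initial_continuous. Qed.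

Lemma continuous_proj01 (R : realType) : continuous (@proj01 R).
Proof.
apply/continuous_comp_initial => x.
apply: (@continuous_max R R (fun=> 0) (fun y => Num.min 1 y)); first exact: cvg_cst.
by apply: (@continuous_min R R (fun=> 1) id); [exact: cvg_cst|exact: cvg_id].
Qed.

(** Clamping before applying [T] gives a real map with the same orbits on [0, 1], as
    [sparse_intervals] expects. *)
Lemma continuous_extension (R : realType) (T : I01 R -> I01 R) :
  continuous T -> continuous (fun x : R => set_val (T (proj01 x)) : R).
Proof.
move=> cT x; apply: (@continuous_comp _ _ _ (T \o @proj01 R) set_val).
  by apply: continuous_comp; [exact: continuous_proj01|exact: cT].
exact: continuous_set_val.
Qed.

Lemma iter_extension (R : realType) (T : I01 R -> I01 R) (i : nat) (x : I01 R) :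
  iter i (fun x : R => set_val (T (proj01 x))) (set_val x) = set_val (iter i T x).
Proof. by elim: i => //= i ->; rewrite proj01K. Qed.

(* At scale 1/E this says log N(n) <= (4 / L) n log E for large n. *)
Definition slow_growth (R : realType) (T : I01 R -> I01 R) (g : R -> R)
    (L E : nat) : Prop :=
  exists n0, forall n m (x : 'I_m -> I01 R), (n0 <= n)%N ->
    (forall i j, i != j ->
      E%:R^-1 <= bowen_metric (pullback_metric g) T n (x i) (x j)) ->
    (m ^ L <= E ^ (4 * n))%N.

(** * One step of the construction *)

Lemma slots_exist (R : realType) (T : I01 R -> I01 R) (M L : nat) :
  continuous T -> (0 < M)%N ->
  exists (a b : 'I_M -> R) (per : pred 'I_M),
    [/\ slotted a b,
        forall j (y : I01 R), per j -> a j <= set_val y <= b j ->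
          iter L`! T y = y &
        forall j l i (y : I01 R), ~~ per j -> ~~ per l -> (0 < i < L)%N ->
          a j <= set_val y <= b j -> ~~ (a l <= set_val (iter i T y) <= b l)].
Proof.
move=> cT M0.
have MR : 0 < M%:R :> R by rewrite ltr0n.
have [|a [b [per [ref perP sparse]]]] := @sparse_intervals R 'I_M _ L
    (fun j => j%:R / M%:R) (fun j => j.+1%:R / M%:R) (continuous_extension cT).
  by move=> j; rewrite ltr_pM2r ?invr_gt0// ltr_nat.
exists a, b, per; split=> //.
  by move=> j y pj /(perP _ _ pj); rewrite iter_extension; apply: val_inj.
by move=> j l i y nj nl iL yj; rewrite -iter_extension; apply: sparse yj.
Qed.

(* E is chosen after the number M of slots, so the 4^M symbols cost at most
   E^(1/L) per unit of time; the gaps between the subintervals carry at most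
   1/(4E) of the increase of h'. *)
Lemma zoom_step (R : realType) (T : I01 R -> I01 R) (h : R -> R) (e : R)
    (L : nat) :
  continuous T -> bilipschitz_homeo h -> 0 < e -> (0 < L)%N ->
  exists h' e' E,
    [/\ bilipschitz_homeo h', 0 < e', e' <= e / 2, e' <= L%:R^-1 & (L < E)%N] /\
    [/\ forall x, 0 <= x <= 1 -> `|h' x - h x| <= e / 2,
        forall x y, 0 <= x -> y <= 1 -> L%:R^-1 <= y - x ->
          3 * e' <= h' y - h' x &
        forall g, (forall x, 0 <= x <= 1 -> 0 <= g x <= 1) ->
          (forall x, 0 <= x <= 1 -> `|g x - h' x| <= e') ->
          slow_growth T g L E].
Proof.
move=> cT hh e0 L0; have [_ _ [c [l [c0 l0 hP]]]] := hh.
(* As [squeeze] moves points by at most [1/M], composing with it changes [h] by at most [l / M]. *)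
have [M M0 lM] : exists2 M, (0 < M)%N & l / M%:R <= e / 2.
  exists (Num.truncn (l / (e / 2))).+1 => //.
  rewrite ler_pdivrMr ?ltr0n// -ler_pdivrMl ?divr_gt0// mulrC ltW//.
  have /truncn_itv/andP[_ //] : 0 <= l / (e / 2).
  by rewrite divr_ge0// ltW// divr_gt0.
have [a [b [per [sl perP sparse]]]] := slots_exist L cT M0.
have [E [E1 AE LE]] : exists E, [/\ (1 < E)%N, ((4 ^ M) ^ L <= E)%N & (L < E)%N].
  by exists ((4 ^ M) ^ L + L + 2)%N; split; lia.
have E0 : 0 < E%:R :> R by rewrite ltr0n ltnW.
have LR : 0 < L%:R :> R by rewrite ltr0n.
pose s : R := (4 * E%:R)^-1.
have s0 : 0 < s by rewrite invr_gt0 mulr_gt0.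
have sE : 4 * s = E%:R^-1 by rewrite /s; field; rewrite gt_eqF.
have s1 : s < 1.
  by rewrite invf_lt1 ?mulr_gt0// -natrM ltr1n; lia.
pose h' x := (1 - s) * h (squeeze a b x) + s * h x.
have hh' : bilipschitz_homeo h' by apply: bilipschitz_squeeze; rewrite ?s0.
have [_ _ [c' [l' [c'0 l'0 hP']]]] := hh'.
(* The term [e / 2] keeps the error bounds nested; [s / 2] makes [g] vary by at most
   [s + 2 e' <= 2 s < 1/E] on a gap; [c' / (3 L)] turns the lower slope [c'] into the separation
   [3 e']. *)
pose e' := Num.min (Num.min (e / 2) (s / 2)) (c' / (3 * L%:R)).
have e'0 : 0 < e' by rewrite /e' !lt_min !divr_gt0// mulr_gt0.
have e'e : e' <= e / 2 by rewrite /e' !ge_min lexx.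
have e's : e' <= s / 2 by rewrite /e' !ge_min lexx orbT.
have e'c : e' <= c' / (3 * L%:R) by rewrite /e' !ge_min lexx orbT.
have EL : E%:R^-1 <= L%:R^-1 :> R.
  by rewrite lef_pV2 ?posrE// ler_nat ltnW.
exists h', e', E; split; first by split=> //; lra.
split.
- move=> x x01; have [q01 qx] := squeeze_near M0 sl x01.
  set y := squeeze a b x in q01 qx.
  have hyx : `|h y - h x| <= e / 2.
    apply: le_trans lM; apply: (@le_trans _ _ (l * `|y - x|)); last first.
      by rewrite ler_wpM2l.
    case/andP: x01 q01 => x0 x1 /andP[y0 y1].
    have lip u v : 0 <= u -> u <= v -> v <= 1 -> `|h v - h u| <= l * `|v - u|.
      move=> u0 uv v1; have /andP[p1 p2] := hP _ _ u0 uv v1.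
      rewrite [`|v - u|]ger0_norm ?subr_ge0// ger0_norm//.
      by apply: le_trans p1; rewrite mulr_ge0 ?subr_ge0 ?(ltW c0).
    have [xy|yx] := leP x y; first exact: lip.
    by rewrite distrC [`|y - x|]distrC; apply: lip => //; apply: ltW.
  rewrite /h' -/y; have -> : (1 - s) * h y + s * h x - h x = (1 - s) * (h y - h x).
    by ring.
  rewrite normrM ger0_norm ?subr_ge0 ?(ltW s1)//; apply: le_trans hyx.
  by rewrite ler_piMl//; lra.
- move=> x y x0 y1 xy.
  have L'0 : 0 < L%:R^-1 :> R by rewrite invr_gt0.
  have xley : x <= y by lra.
  have /andP[h1 _] := hP' x y x0 xley y1.
  apply: le_trans h1; apply: (@le_trans _ _ (c' * L%:R^-1)); last first.
    by rewrite ler_pM2l.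
  have -> : c' * L%:R^-1 = 3 * (c' / (3 * L%:R)) by field; rewrite gt_eqF.
  by rewrite ler_pM2l.
(* This is the threshold of [slot_count_bound] with [q] equal to L!. *)
move=> g g01 gh; exists (2 * L + 2 * (L * L`!))%N => n m x nL sep.
apply: (slot_count_bound E1 AE nL).
apply: separated_orbits_slots perP sparse g01 _ sep => //.
- exact: fact_gt0.
- exact: ltnW.
move=> y z y01 z01 same gap.
have hyz : `|h' y - h' z| <= s.
  rewrite /h' (squeeze_gap sl same gap).
  have -> : (1 - s) * h (squeeze a b z) + s * h y -
    ((1 - s) * h (squeeze a b z) + s * h z) = s * (h y - h z) by ring.
  rewrite normrM gtr0_norm// ger_pMr// ler_norml.
  have /andP[? ?] := bilipschitz_itv hh y01.
  have /andP[? ?] := bilipschitz_itv hh z01.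
  by apply/andP; split; lra.
have := gh y y01; have := gh z z01; move: hyz; rewrite !ler_norml ltr_norml.
by move=> /andP[? ?] /andP[? ?] /andP[? ?]; apply/andP; split; lra.
Qed.

(** * The limit homeomorphism *)

Lemma ltr_harmonic (R : realType) (e : R) : 0 < e -> exists k, k.+1%:R^-1 < e.
Proof.
move=> e0; exists (Num.truncn e^-1).
have /truncn_itv/andP[_ lt] : 0 <= e^-1 by rewrite invr_ge0 ltW.
by rewrite -[ltRHS]invrK ltf_pV2 ?posrE ?invr_gt0// ltr0n.
Qed.

Lemma bilipschitz_id (R : realType) : bilipschitz_homeo (@id R).
Proof.
split=> //; exists 1, 1; split=> // x y _ _ _ /=.
by rewrite mul1r lexx.
Qed.

(** Iterate [zoom_step] with [L = k.+1]. Each step moves the map by at most half the current error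
    bound and at least halves that bound, so the limit is within [ek k] of [hk k] and inherits
    separation and slow growth from every stage. Slopes are not controlled in the limit, whence the
    moduli in the conclusion. *)
Lemma slow_homeo (R : realType) (T : I01 R -> I01 R) :
  continuous T ->
  exists h : R -> R,
    [/\ h 0 = 0, h 1 = 1,
        forall c, 0 < c -> exists2 r, 0 < r & forall x y,
          0 <= x -> y <= 1 -> c <= y - x -> r <= h y - h x,
        forall e, 0 < e -> exists2 r, 0 < r & forall x y,
          0 <= x <= 1 -> 0 <= y <= 1 -> `|x - y| < r -> `|h x - h y| < e &
        forall L, exists E, (L < E)%N /\ slow_growth T h L E].
Proof.
move=> cT.
(* Keeping the conditions on the state inside the existential makes [next] total; a state violating
   them is returned unchanged. *)
have /choice[next nextP] : forall khe : nat * ((R -> R) * R), exists he' : (R -> R) * R,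
  bilipschitz_homeo khe.2.1 -> 0 < khe.2.2 -> exists E,
    [/\ bilipschitz_homeo he'.1, 0 < he'.2, he'.2 <= khe.2.2 / 2,
        he'.2 <= khe.1.+1%:R^-1 & (khe.1.+1 < E)%N] /\
    [/\ forall x, 0 <= x <= 1 -> `|he'.1 x - khe.2.1 x| <= khe.2.2 / 2,
        forall x y, 0 <= x -> y <= 1 -> khe.1.+1%:R^-1 <= y - x ->
          3 * he'.2 <= he'.1 y - he'.1 x &
        forall g, (forall x, 0 <= x <= 1 -> 0 <= g x <= 1) ->
          (forall x, 0 <= x <= 1 -> `|g x - he'.1 x| <= he'.2) ->
          slow_growth T g khe.1.+1 E].
  move=> [k [h e]] /=.
  have [[hh e0]|no] := pselect (bilipschitz_homeo h /\ 0 < e).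
    by have [h' [e' [E P]]] := zoom_step cT hh e0 (ltn0Sn k);
       exists (h', e') => _ _; exists E.
  by exists (h, e) => hh e0; case: no.
pose fix st k : (R -> R) * R := if k is k'.+1 then next (k', st k') else (id, 1).
have stP k : bilipschitz_homeo (st k).1 /\ 0 < (st k).2.
  elim: k => [|k [hh e0]] /=; first by split=> //; exact: bilipschitz_id.
  by have [E [[]]] := nextP (k, st k) hh e0.
have stepP k := nextP (k, st k) (stP k).1 (stP k).2.
pose hk k := (st k).1; pose ek k := (st k).2.
have ek0 k : 0 < ek k by exact: (stP k).2.
have ekS k : ek k.+1 <= k.+1%:R^-1 by have [E [[]]] := stepP k.
have nested x k m : 0 <= x <= 1 -> (k <= m)%N -> `|hk m x - hk k x| + ek m <= ek k.
  move=> x01 /subnKC <-; elim: (m - k)%N => [|j IH].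
    by rewrite addn0 subrr normr0 add0r.
  rewrite addnS; have [E [[_ _ e2 _ _] [/(_ x x01) h2 _ _]]] := stepP (k + j)%N.
  have := ler_distD (hk (k + j)%N x) (hk (k + j).+1 x) (hk k x).
  rewrite /= -/(st _) in e2 h2; rewrite /hk /ek /= in IH *; lra.
have cross x k m : 0 <= x <= 1 -> hk m x - ek m <= hk k x + ek k.
  move=> x01; have := ek0 m; have := ek0 k; have [km|/ltnW mk] := leqP k m.
    have := nested x _ _ x01 km; have := ler_norm (hk m x - hk k x); lra.
  have := nested x _ _ x01 mk; have := ler_norm (- (hk k x - hk m x)).
  rewrite normrN; lra.
(* The intervals [hk k x - ek k, hk k x + ek k] are nested. *)
pose h x := sup (range (fun k => hk k x - ek k)).
have hE x k : 0 <= x <= 1 -> `|h x - hk k x| <= ek k.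
  move=> x01; rewrite ler_norml; apply/andP; split.
    have : hk k x - ek k <= h x.
      apply: ub_le_sup; last by exists k.
      by exists (hk 0 x + ek 0%N) => _ [m _ <-]; apply: cross.
    lra.
  have : h x <= hk k x + ek k.
    apply: ge_sup; first by exists (hk 0 x - ek 0%N); exists 0%N.
    by move=> _ [m _ <-]; apply: cross.
  lra.
have itv0 : 0 <= (0 : R) <= 1 by rewrite lexx ler01.
have itv1 : 0 <= (1 : R) <= 1 by rewrite lexx ler01.
have small e : 0 < e -> exists k, ek k.+1 < e.
  by move=> /ltr_harmonic[k ke]; exists k; apply: le_lt_trans (ekS k) ke.
have uniq x c : 0 <= x <= 1 -> (forall k, hk k x = c) -> h x = c.
  move=> x01 hc; apply/eqP; rewrite -subr_eq0 -normr_le0; apply/ler_addgt0Pr => e e0.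
  have [k ke] := small e e0; rewrite add0r; apply: le_trans (ltW ke).
  by have := hE x k.+1 x01; rewrite hc.
have h01 x : 0 <= x <= 1 -> 0 <= h x <= 1.
  move=> x01; apply/andP; split; apply/ler_addgt0Pr => e e0;
    have [k ke] := small e e0; have := hE x k.+1 x01; rewrite ler_norml;
    have := bilipschitz_itv (stP k.+1).1 x01; rewrite -/(hk k.+1);
    by move=> /andP[? ?] /andP[? ?]; lra.
exists h; split.
- by apply: uniq => // k; have [[]] := stP k.
- by apply: uniq => // k; have [[]] := stP k.
(* The stage separates by [3 * ek k.+1], and passing to [h] costs [ek k.+1] at each endpoint. *)
- move=> c /ltr_harmonic[k kc]; exists (ek k.+1) => // x y x0 y1 xy.
  have [E [_ [_ /(_ x y x0 y1) sep _]]] := stepP k.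
  have k0 : 0 < k.+1%:R^-1 :> R by rewrite invr_gt0 ltr0n.
  have c0 : 0 < c := lt_trans k0 kc.
  have := sep (le_trans (ltW kc) xy); rewrite -/(st k.+1) -/(hk k.+1) -/(ek k.+1).
  have := hE x k.+1; have := hE y k.+1; rewrite !ler_norml.
  have -> : 0 <= x <= 1 by apply/andP; split; lra.
  have -> : 0 <= y <= 1 by apply/andP; split; lra.
  by move=> /(_ isT)/andP[? ?] /(_ isT)/andP[? ?]; lra.
(* Two approximation errors below [e / 4] are added to a Lipschitz term of at most [e / 2]; [l + 1]
   avoids a zero denominator. *)
- move=> e e0; have [k ke] := small (e / 4) (divr_gt0 e0 (ltr0n _ 4)).
  have [[_ _ [s [l [s0 l0 lip]]]] _] := stP k.+1.
  exists (e / (2 * (l + 1))); first by rewrite divr_gt0//; lra.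
  have key u v : 0 <= u <= 1 -> 0 <= v <= 1 -> u <= v -> v - u < e / (2 * (l + 1)) ->
      `|h u - h v| < e.
    move=> u01 v01 uv vu; have /andP[u0 u1] := u01; have /andP[v0 v1] := v01.
    have /andP[dn up] := lip u v u0 uv v1.
    have small2 : l * (v - u) <= e / 2.
      have -> : e / 2 = (l + 1) * (e / (2 * (l + 1))) by field; rewrite gt_eqF; lra.
      by apply: ler_pM; lra.
    have dn0 : 0 <= s * (v - u) by rewrite mulr_ge0 ?subr_ge0// ltW.
    rewrite -/(hk k.+1) in dn up.
    have := hE u k.+1 u01; have := hE v k.+1 v01; rewrite !ler_norml ltr_norml.
    by move=> /andP[? ?] /andP[? ?]; apply/andP; split; lra.
  move=> x y x01 y01; have [xy|yx] := leP x y.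
    by rewrite distrC ger0_norm ?subr_ge0//; apply: key.
  rewrite ger0_norm ?subr_ge0 1?ltW// distrC; apply: key => //; exact: ltW.
(* The stages have parameters [k.+1], so [L = 0] is separate: the bound reads [1 <= 1] with
   [E = 1]. *)
case=> [|L].
  by exists 1%N; split=> //; exists 0%N => n m x _ _; rewrite expn0 exp1n.
have [E [[_ _ _ _ LE] [_ _ slow]]] := stepP L.
by exists E; split=> //; apply: slow h01 _ => x x01; apply: (hE x L.+1).
Qed.

(** * Lower and upper limits, separation numbers *)

Section ExtendedLimits.
Context {R : realType} {Y : choiceType} {X : filteredType Y}.
Context {F : set_system X} {FF : ProperFilter F}.
Implicit Types (f : X -> \bar R) (c : \bar R).

Lemma limf_einf_ge f c : (\forall x \near F, c <= f x)%E -> (c <= limf_einf f F)%E.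
Proof.
move=> cf; rewrite limf_einfE.
apply: (@le_trans _ _ (ereal_inf (f @` [set x | c <= f x]%E))); last first.
  by apply: ereal_sup_ubound; exists [set x | c <= f x]%E.
by apply: le_ereal_inf_tmp => _ [x /= cx <-].
Qed.

Lemma limf_esup_le f c : (\forall x \near F, f x <= c)%E -> (limf_esup f F <= c)%E.
Proof.
move=> fc; rewrite limf_esupE.
apply: (@le_trans _ _ (ereal_sup (f @` [set x | f x <= c]%E))).
  by apply: ereal_inf_lbound; exists [set x | f x <= c]%E.
by apply: ge_ereal_sup => _ [x /= cx <-].
Qed.

(** A bound attained somewhere in each member of the filter suffices, so a lower limit over scales
    can be tested at isolated scales [1/E]. *)
Lemma limf_einf_le f c :
  (forall V, F V -> exists2 x, V x & (f x <= c)%E) -> (limf_einf f F <= c)%E.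
Proof.
move=> fc; rewrite limf_einfE; apply: ge_ereal_sup => _ [V FV <-].
have [x Vx fx] := fc V FV; apply: le_trans fx.
by apply: ereal_inf_lbound; exists x.
Qed.

Lemma limf_esup_ge f c : (\forall x \near F, c <= f x)%E -> (c <= limf_esup f F)%E.
Proof.
move=> cf; rewrite limf_esupE; apply: le_ereal_inf_tmp => _ [V FV <-].
have [x [Vx cx]] := filter_ex (filterI FV cf); apply: le_trans cx _.
by apply: ereal_sup_ubound; exists x.
Qed.

End ExtendedLimits.

Lemma separation_number_ge (R : realType) (U : topologicalType)
    (rho : U -> U -> R) (e : R) (m : nat) (x : 'I_m -> U) :
  injective x -> (forall i j, i != j -> e <= rho (x i) (x j)) ->
  (m%:R%:E <= separation_number rho e)%E.
Proof.
move=> injx sep; apply: ereal_sup_ubound; exists m => //; exists (range x); split.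
  move=> _ _ [i _ <-] [j _ <-] xij; apply: sep.
  by apply/eqP => ij; apply: xij; rewrite ij.
apply: card_eq_trans (inj_card_eq _) _; first by move=> i j _ _; apply: injx.
by rewrite card_eq_sym; apply: card_II.
Qed.

(** Enumerating a finite separated set gives an indexed family, the form used in the counting
    bounds. *)
Lemma separation_number_le (R : realType) (U : topologicalType)
    (rho : U -> U -> R) (e : R) (c : \bar R) :
  (forall m (x : 'I_m -> U), (forall i j, i != j -> e <= rho (x i) (x j)) ->
    (m%:R%:E <= c)%E) ->
  (separation_number rho e <= c)%E.
Proof.
move=> cP; apply: ge_ereal_sup => _ [m [S [sepS cS]] <-].
have [f bijf] := card_set_bijP cS.
have /choice[x xP] : forall i : 'I_m, exists y, S y /\ f y = i.
  by move=> i; have [y Sy fy] := set_bij_surj bijf (ltn_ord i); exists y.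
apply: (cP m x) => i j ij; have [[Si fi] [Sj fj]] := (xP i, xP j).
apply: sepS => // xij; move/eqP: ij; apply; apply: val_inj.
by rewrite /= -fi -fj xij.
Qed.

Lemma separation_number_ge1 (R : realType) (U : topologicalType)
    (rho : U -> U -> R) (e : R) (y : U) : (1 <= separation_number rho e)%E.
Proof.
apply: (@separation_number_ge _ _ _ _ 1 (fun=> y)).
  by move=> i j _; rewrite !ord1.
by move=> i j; rewrite !ord1 eqxx.
Qed.

(** * Metric mean dimension under slow growth *)

Lemma mdimM_rel_ge0 (R : realType) (T : I01 R -> I01 R) (d : I01 R -> I01 R -> R) :
  (0 <= mdimM_rel T d)%E.
Proof.
apply: limf_einf_ge; near=> e.
have e0 : 0 < e by near: e; exact: nbhs_right_gt.
apply: limf_esup_ge; apply: nearW => n.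
apply: mule_ge0; first by rewrite lne_ge0 (separation_number_ge1 _ _ (proj01 0)).
rewrite inve_ge0 lee_fin mulr_ge0// ln_ge0// div1r invf_ge1//; near: e.
exact/nbhs_right_ltW/ltr01.
Unshelve. all: end_near. Qed.

Lemma lne_ratio_le (R : realType) (N : \bar R) (b y z : R) :
  (0 <= N)%E -> (N <= (expR b)%:E)%E -> 0 < y -> b <= z * y ->
  (lne N / y%:E <= z%:E)%E.
Proof.
move=> N0 Nb y0 bzy; rewrite inver gt_eqF// lee_pdivrMr//.
apply: (@le_trans _ _ b%:E); last by rewrite -EFinM lee_fin.
rewrite -[b in leRHS]expRK -lne_EFin ?expR_gt0// lee_lne//.
  by rewrite in_itv /= N0 leey.
by rewrite in_itv /= lee_fin expR_ge0 leey.
Qed.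

Lemma at_right0_inv (R : realType) (V : set R) :
  nbhs 0^'+ V -> exists L : nat, forall E, (L < E)%N -> V E%:R^-1.
Proof.
move=> /nbhs_ballP[r /= r0 rV]; have [L Lr] := ltr_harmonic r0.
exists L => E LE; have E0 : 0 < E%:R :> R by rewrite ltr0n; lia.
have EL : E%:R^-1 <= L.+1%:R^-1 :> R by rewrite lef_pV2 ?posrE// ler_nat.
apply: rV; rewrite /= ?invr_gt0// /ball /= sub0r normrN gtr0_norm ?invr_gt0//.
exact: le_lt_trans EL Lr.
Qed.

Lemma mdimM_rel_slow (R : realType) (T : I01 R -> I01 R) (h : R -> R) :
  (forall L, exists E, (L < E)%N /\ slow_growth T h L E) ->
  mdimM_rel T (pullback_metric h) = 0%E.
Proof.
move=> slow; apply/eqP; rewrite eq_le mdimM_rel_ge0 andbT.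
apply/lee_addgt0Pr => c c0; rewrite add0e.
apply: limf_einf_le => V /at_right0_inv[L0 LV].
have [L1 L1c] := ltr_harmonic (divr_gt0 c0 (ltr0n R 4)).
(* [L > L0] puts [1/E] in [V], and [L > L1] gives [4 / L < c]. *)
pose L := (L0 + L1).+1.
have [E [LE [n0 grow]]] := slow L.
exists E%:R^-1; first by apply: LV; rewrite /L in LE; lia.
have E1 : 1 < E%:R :> R by rewrite ltr1n; rewrite /L in LE; lia.
have E0 : (0 < E)%N by lia.
have lnE : 0 < ln (E%:R : R) by rewrite ln_gt0.
have LR : 0 < L%:R :> R by rewrite ltr0n.
apply: limf_esup_le; near=> n.
have n0n : (n0 <= n)%N by near: n; exact: nbhs_infty_ge.
have n_gt0 : 0 < n%:R :> R by rewrite ltr0n; near: n; exact: nbhs_infty_gt.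
apply: (@lne_ratio_le _ _ ((4 * n)%:R / L%:R * ln E%:R)).
- by apply: le_trans (separation_number_ge1 _ _ (proj01 0)).
- apply: separation_number_le => m x sep; rewrite lee_fin.
  have [->|m0] := posnP m; first exact: expR_ge0.
  have mR : (m%:R : R) \is Num.pos by rewrite posrE ltr0n.
  have := grow n m x n0n sep; rewrite -(ler_nat R) !natrX.
  rewrite -ler_ln ?posrE ?exprn_gt0 ?ltr0n//.
  rewrite !lnXn ?ltr0n//.
  move=> lnm; rewrite -[leLHS]lnK// ler_expR.
  by rewrite mulrAC ler_pdivlMr// mulr_natr mulr_natl.
- by rewrite mulr_gt0// div1r invrK.
rewrite div1r invrK mulrA ler_pM2r// natrM mulrAC ler_pM2r//.
have L1L : L%:R^-1 <= L1.+1%:R^-1 :> R by rewrite lef_pV2 ?posrE// ler_nat /L; lia.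
by have := le_lt_trans L1L L1c; rewrite ltr_pdivlMr// mulrC => /ltW.
Unshelve. all: end_near. Qed.

(** * Topology and Minkowski dimension of the pullback metric *)

Section PullbackMetric.
Context {R : realType} (h : R -> R).
Context (h_sep : forall c, 0 < c -> exists2 r, 0 < r & forall x y,
  0 <= x -> y <= 1 -> c <= y - x -> r <= h y - h x).
Context (h_cont : forall e, 0 < e -> exists2 r, 0 < r & forall x y,
  0 <= x <= 1 -> 0 <= y <= 1 -> `|x - y| < r -> `|h x - h y| < e).

(** Uniform continuity of the inverse of [h]; it yields both the separation axiom of the metric and
    one half of the comparison of topologies. *)
Lemma pullback_sep (c : R) : 0 < c -> exists2 r, 0 < r & forall x y : I01 R,
  pullback_metric h x y < r -> `|set_val x - set_val y| < c.
Proof.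
move=> /h_sep[r r0 rP]; exists r => // x y; rewrite /pullback_metric => hxy.
rewrite ltNge; apply/negP => cxy; move: hxy; apply/negP; rewrite -leNgt.
have /andP[x0 x1] := I01_itv x; have /andP[y0 y1] := I01_itv y.
have [xy|yx] := leP (set_val x) (set_val y).
  have := rP _ _ x0 y1; rewrite distrC ger0_norm ?subr_ge0// in cxy.
  by move=> /(_ cxy) le; rewrite distrC (le_trans le)// ler_norm.
have := rP _ _ y0 x1; rewrite gtr0_norm ?subr_gt0// in cxy.
by move=> /(_ cxy) le; rewrite (le_trans le)// ler_norm.
Qed.

Lemma pullback_is_metric : is_metric (pullback_metric h).
Proof.
split=> [x y|x y|x y|x y z]; rewrite /pullback_metric //.
- split=> [hxy|->]; last by rewrite subrr normr0.
  apply: val_inj; apply/eqP; rewrite -subr_eq0 -normr_le0; apply/ler_addgt0Pr => e e0.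
  have [r r0 rP] := pullback_sep e0; rewrite add0r ltW//.
  by apply: rP; rewrite /pullback_metric hxy.
- exact: distrC.
- exact: ler_distD.
Qed.

Lemma pullback_induces_topology : induces_topology (pullback_metric h).
Proof.
move=> U; split=> [[B oB <-] x Bx|UP].
  have /nbhs_ballP[c /= c0 cB] : nbhs (set_val x) B by exact: open_nbhs_nbhs.
  have [r r0 rP] := pullback_sep c0; exists r => // y /= /rP xy.
  by apply: cB; rewrite /ball.
rewrite openE => x Ux; have [e e0 eU] := UP x Ux.
have [r r0 rP] := h_cont e0.
apply: (@filterS _ _ _ (set_val @^-1` ball (set_val x) r)).
  by move=> y xy; apply: eU; apply: rP; rewrite ?I01_itv.
by apply: continuous_set_val; apply: nbhsx_ballx.
Qed.

Context (h0 : h 0 = 0) (h1 : h 1 = 1).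

Lemma pullback_onto (v : R) : 0 <= v <= 1 -> exists x : I01 R, h (set_val x) = v.
Proof.
move=> v01; pose f x := h (set_val (proj01 x : I01 R)).
have cf : continuous f.
  move=> x; apply/cvgrPdist_lt => e e0; have [r r0 rP] := h_cont e0.
  have cp : {for x, continuous (fun x : R => set_val (proj01 x : I01 R) : R)}.
    apply: (@continuous_comp _ _ _ (@proj01 R) set_val).
      exact: continuous_proj01.
    exact: continuous_set_val.
  have /cvgrPdist_lt/(_ r r0) := cp; apply: filterS => y xy.
  by apply: rP; rewrite ?I01_itv.
have f0 : f 0 = 0.
  by rewrite /f set_val_proj01// lexx ler01.
have f1 : f 1 = 1.
  by rewrite /f set_val_proj01// lexx ler01.
have [|x _ fx] := @IVT R f 0 1 v ler01 (continuous_subspaceT cf).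
  by rewrite f0 f1 min_l// max_r.
by exists (proj01 x).
Qed.

Context (h01 : forall x, 0 <= x <= 1 -> 0 <= h x <= 1).

(** Take preimages of the multiples of [e] in [0, 1]: counting 0, their number is the integer part
    of [1/e] plus one. *)
Lemma pullback_separation_ge (e : R) : 0 < e ->
  ((e^-1)%:E <= separation_number (pullback_metric h) e)%E.
Proof.
move=> e0; have /truncn_itv/andP[k1 k2] : 0 <= e^-1 by rewrite invr_ge0 ltW.
pose m := (Num.truncn e^-1).+1.
have /choice[x xP] : forall i : 'I_m, exists x : I01 R, h (set_val x) = i%:R * e.
  move=> i; apply: pullback_onto; rewrite mulr_ge0 ?(ltW e0)//=.
  rewrite -ler_pdivlMr// div1r; apply: le_trans k1.
  by rewrite ler_nat -ltnS.
have sep i j : i != j -> e <= pullback_metric h (x i) (x j).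
  move=> ij; rewrite /pullback_metric !xP -mulrBl normrM (gtr0_norm e0).
  rewrite ler_peMl ?(ltW e0)//.
  wlog lt_ij : i j ij / (i < j)%N.
    move=> H; have [/H|/H|/val_inj/eqP] := ltngtP i j; last by rewrite (negPf ij).
      exact.
    by rewrite distrC; apply; rewrite eq_sym.
  by rewrite distrC -natrB ?(ltnW lt_ij)// normr_nat ler1n subn_gt0.
apply: le_trans (separation_number_ge _ sep); first by rewrite lee_fin ltW.
move=> i j xij; apply/eqP; apply: contraT => /sep.
by rewrite xij /pullback_metric subrr normr0 leNgt e0.
Qed.

(** Each cell of length [e] holds the image of at most one point, equal integer parts forcing
    distance below [e]. *)
Lemma pullback_separation_le (e : R) : 0 < e ->
  (separation_number (pullback_metric h) e <= (e^-1 + 1)%:E)%E.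
Proof.
move=> e0; have c0 : 0 < e^-1 by rewrite invr_gt0.
have /truncn_itv/andP[k1 _] := ltW c0.
apply: separation_number_le => m x sep; rewrite lee_fin.
pose cell i : 'I_(Num.truncn e^-1).+1 := inord (Num.truncn (e^-1 * h (set_val (x i)))).
have hx i := h01 (I01_itv (x i)).
have injc : injective cell.
  move=> i j /(congr1 val); rewrite /= !inordK ?ltnS ?truncn_mul_le ?(ltW c0)//.
  have [/andP[hi _] /andP[hj _]] := (hx i, hx j).
  move=> /(truncn_eq_near c0 hi hj); rewrite invrK => lt.
  by apply/eqP; apply: contraT => /sep; rewrite leNgt lt.
have := leq_card _ injc; rewrite !card_ord -(ler_nat R) -natr1 => le.
by apply: le_trans le _; rewrite lerD2r.
Qed.

Lemma pullback_minkowski : upper_minkowski_dim (pullback_metric h) = 1%E.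
Proof.
apply/eqP; rewrite eq_le; apply/andP; split.
  apply/lee_addgt0Pr => c c0; apply: limf_esup_le; near=> e.
  have e0 : 0 < e by near: e; exact: nbhs_right_gt.
  have e1 : e < 1 by near: e; exact/nbhs_right_lt/ltr01.
  (* For [e < 1] the count is at most [2/e], so the ratio exceeds 1 by at most [ln 2 / (- ln e)],
     which is below [c] under this threshold. *)
  have el : e < expR (- (ln 2 / c)) by near: e; apply: nbhs_right_lt; exact: expR_gt0.
  have ln1e : ln (1 / e) = - ln e by rewrite div1r lnV ?posrE.
  have lne : ln 2 / c < - ln e.
    rewrite ltrNr -ltr_expR lnK ?posrE//.
  rewrite -EFinD; apply: (@lne_ratio_le _ _ (ln 2 - ln e)).
  - by apply: le_trans (separation_number_ge1 _ _ (proj01 0)).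
  - apply: le_trans (pullback_separation_le e0) _; rewrite lee_fin.
    rewrite expRD expRN !lnK ?posrE//.
    by rewrite mulr_natl mulr2n lerD2l invf_ge1// ltW.
  - by rewrite ln1e oppr_gt0 ln_lt0// e0.
  - rewrite ln1e mulrDl mul1r addrC lerD2l.
    by rewrite mulrC -ler_pdivrMr// ltW.
apply: limf_esup_ge; near=> e.
have e0 : 0 < e by near: e; exact: nbhs_right_gt.
have e1 : e < 1 by near: e; exact/nbhs_right_lt/ltr01.
have ln0 : 0 < ln (1 / e) by rewrite ln_gt0// div1r invf_gt1.
rewrite inver gt_eqF// lee_pdivlMr// mul1e -lne_EFin ?div1r ?invr_gt0//.
rewrite lee_lne ?pullback_separation_ge// in_itv /= leey andbT.
  by rewrite lee_fin invr_ge0 ltW.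
by apply: le_trans (separation_number_ge1 _ _ (proj01 0)).
Unshelve. all: end_near. Qed.

End PullbackMetric.

Theorem theorem6 (R : realType) (T : I01 R -> I01 R) (hT : continuous T) :
  mdimM R T = 0%E /\
  exists d : I01 R -> I01 R -> R,
    [/\ is_metric d, induces_topology d,
        mdimM_rel T d = 0%E & upper_minkowski_dim d = 1%E].
Proof.
have [h [h0 h1 h_sep h_cont slow]] := slow_homeo hT.
have h01 x : 0 <= x <= 1 -> 0 <= h x <= 1.
  have mono y z : 0 <= y -> y <= z -> z <= 1 -> h y <= h z.
    rewrite le_eqVlt => y0 + z1; rewrite le_eqVlt => /predU1P[->//|yz].
    have [|r r0 rP] := h_sep (z - y); first by rewrite subr_gt0.
    have := rP y z (_ : 0 <= y) z1 (lexx _); lra.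
  by move=> /andP[x0 x1]; rewrite -[X in X <= _]h0 -[X in _ && (_ <= X)]h1 !mono.
have dmet := pullback_is_metric h_sep.
have dtop := pullback_induces_topology h_sep h_cont.
have dmdim := mdimM_rel_slow slow.
split; last first.
  by exists (pullback_metric h); split=> //; apply: pullback_minkowski.
apply/eqP; rewrite eq_le; apply/andP; split.
  by rewrite -dmdim; apply: ereal_inf_lbound; exists (pullback_metric h).
by apply: le_ereal_inf_tmp => _ [d _ <-]; apply: mdimM_rel_ge0.
Qed.
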